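(* Let $S$ be a commutative ring, let $m \in \mathbb{N}$, and let $A \in \mathbb{M}_m(S)$. Then for any positive integer $n$, $A^n\mathbb{M}_m(S) = A^{n+1}\mathbb{M}_m(S)$ implies $\mathbb{M}_m(S)A^n = \mathbb{M}_m(S)A^{n+1}$.
   Context: Rings are associative with unity. $\mathbb{M}_m(S)$ denotes the ring of $m \times m$ matrices over $S$. For an element $B$ of a ring $R$, $BR = \{Br : r \in R\}$ and $RB = \{rB : r \in R\}$. *)

(* Defs.v *)
From HB Require Import structures.
From mathcomp Require Import all_boot all_order all_algebra.
From mathcomp Require Import classical_sets.
Set Implicit Arguments.
Unset Strict Implicit.
Unset Printing Implicit Defensive.
Import GRing.Theory.
Local Open Scope ring_scope.
Local Open Scope classical_set_scope.

Definition right_principal (R : pzRingType) (B : R) : set R :=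
  [set B * r | r in [set: R]].

Definition left_principal (R : pzRingType) (B : R) : set R :=
  [set r * B | r in [set: R]].

(* Main.v *)
From HB Require Import structures.
Require Import Defs.
From mathcomp Require Import all_boot all_order all_algebra.
From mathcomp Require Import classical_sets.
Import GRing.Theory.
Local Open Scope ring_scope.

(** If A^n = A^(n+1) X, then A^(n+k) X^k = A^n for all k. Multiplying the
    Cayley-Hamilton identity of X by A^(n+m) on the left therefore reverses
    the characteristic polynomial of X, and its leading coefficient 1 ends up
    in front of A^n while all other terms are multiples of A^(n+1). *)

Lemma expr_absorb (R : pzRingType) (a x : R) (n k : nat) :
  a ^+ n = a ^+ n.+1 * x -> a ^+ (n + k) * x ^+ k = a ^+ n.
Proof.
move=> ax; elim: k => [|k IHk]; first by rewrite addn0 mulr1.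
(* [a] and [x] need not commute, so a factor [a ^+ n.+1] is split off on the right, next to the
   leftmost [x]. *)
rewrite addnS -addSn addnC exprD (exprS x) mulrA -(mulrA _ _ x) -ax.
by rewrite -exprD addnC.
Qed.

(** Any monic [p] annihilating [x] serves here; for matrices it will be the characteristic
    polynomial. *)
Lemma expr_left_of_right (R : comNzRingType) (W : algType R) (p : {poly R})
    (a x : W) (n : nat) :
  p \is monic -> horner_alg x p = 0 ->
  a ^+ n = a ^+ n.+1 * x -> exists y, a ^+ n = y * a ^+ n.+1.
Proof.
move=> /monicP p_monic px0 ax.
have p_gt0 : (0 < size p)%N.
  by rewrite lt0n size_poly_eq0 -lead_coef_eq0 p_monic oner_neq0.
move: p_monic px0; rewrite /lead_coef -{3}(coefK p) poly_def.
case: (size p) p_gt0 => // d _ /= p_d.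
rewrite big_ord_recr /= p_d scale1r raddfD raddf_sum /= => px0.
(* Here [d] is the degree of [p], and [a ^+ (n + d)] turns each [x ^+ k] into [a ^+ (n + d - k)].
   Since [k < d], a right factor [a ^+ n.+1] splits off, leaving [a ^+ (d - k.+1)]. *)
exists (- \sum_(k < d) p`_k *: a ^+ (d - k.+1)).
have := congr1 ( *%R (a ^+ (n + d))) px0.
rewrite mulr0 mulrDr mulr_sumr rmorphXn /= horner_algX.
rewrite (expr_absorb _ _ _ _ _ ax).
move=> /eqP; rewrite addrC addr_eq0 => /eqP ->.
rewrite mulNr mulr_suml; congr (- _); apply: eq_bigr => k _.
rewrite linearZ /= rmorphXn /= horner_algX mulr_algl -scalerAr -scalerAl.
congr (_ *: _).
have -> : (n + d = d - k + (n + k))%N.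
  by rewrite addnCA subnK // ltnW.
rewrite exprD -mulrA (expr_absorb _ _ _ _ _ ax) -!exprD; congr (_ ^+ _).
by rewrite addnS -addSn subnSK.
Qed.

Lemma nz_mx_expr_left_of_right (R : comNzRingType) (m : nat)
    (A X : 'M[R]_m.+1) (n : nat) :
  A ^+ n = A ^+ n.+1 * X -> exists Y, A ^+ n = Y * A ^+ n.+1.
Proof.
apply: (expr_left_of_right _ _ _ _ _ _ (char_poly_monic X)).
(* This identifies [horner_mx X] with [horner_alg X], so that Cayley-Hamilton applies. *)
have := poly_alg_initial (horner_mx X) (char_poly X).
by rewrite /= horner_mx_X Cayley_Hamilton.
Qed.

Lemma mx_expr_left_of_right (S : comPzRingType) (m : nat) (A X : 'M[S]_m)
    (n : nat) :
  A ^+ n = A ^+ n.+1 * X -> exists Y, A ^+ n = Y * A ^+ n.+1.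
Proof.
(* Size [0] and a zero ring [S] are treated apart: there all matrices coincide, so [0] serves as
   [Y]. *)
case: m A X => [|m] A X AX.
  by exists 0; rewrite [LHS]flatmx0 [RHS]flatmx0.
have [S0|S1] := eqVneq (1 : S) 0.
  by exists 0; apply/matrixP => i j; rewrite -[LHS]mul1r -[RHS]mul1r S0 !mul0r.
pose nzS := GRing.PzSemiRing_isNonZero.Build S S1.
pose T : comNzRingType := HB.pack (GRing.ComPzRing.sort S) nzS.
exact: (nz_mx_expr_left_of_right T m A X n AX).
Qed.

Theorem corollary11 (S : comPzRingType) (m : nat) (A : 'M[S]_m) (n : nat)
    (n_gt0 : (0 < n)%N) :
  right_principal (A ^+ n) = right_principal (A ^+ n.+1) ->
  left_principal (A ^+ n) = left_principal (A ^+ n.+1).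
Proof.
move=> AR.
have [X _ AX] : right_principal (A ^+ n.+1) (A ^+ n).
  by rewrite -AR; exists 1; rewrite ?mulr1.
have [Y AY] := mx_expr_left_of_right _ _ _ _ _ (esym AX).
(* The first inclusion uses [Y]; the reverse one holds for every [A]. *)
apply/seteqP; split=> _ [Z _ <-].
  by exists (Z * Y) => //; rewrite AY mulrA.
by exists (Z * A) => //; rewrite exprS mulrA.
Qed.
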